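(* Let $q\ge1$ and $k\ge0$ be integers, and let $G$ be a simple connected graph with $n$ nodes and $m$ edges. Let $\bar{\mathcal K}_{q,k}$ and $\tilde{\mathcal K}_{q,k}$ denote the additive and multiplicative degree-Kirchhoff indices of the iterated $q$-subdivision graph $S_{q,k}(G)$. Then: (i) if $q=2$, $$\begin{aligned}\bar{\mathcal{K}}_{2,k}=\;&4^k\bar{\mathcal{K}}_{2,0}+\frac{2\left(16^k-4^k\right)\tilde{\mathcal{K}}_{2,0}}{3}+\frac{16^k-4^k}{9}\,2m(2m-2n+1)\\&+\frac{16^k}{9}\,4m^2k-\frac{4^k-1}{27}(2m-3n)(2m-3n+3);\end{aligned}$$ (ii) if $q\neq2$, $$\begin{aligned}\bar{\mathcal{K}}_{q,k}=\;&4^k\bar{\mathcal{K}}_{q,0}+\frac{3m^2q^3(q-1)\big[(2q)^{2k}-4^k\big]}{(q-2)(q+1)(2q-1)^2}\\&+\frac{(8q)^k-4^k}{2q-1}\Big(q\tilde{\mathcal{K}}_{q,0}-\frac{2m^2q^2}{3(q-2)}-\frac{m(2n-1)q}{3}\Big)\\&-\frac{mq\big[(2q)^k-4^k\big]}{3(2q-1)}\Big(\frac{2mq}{2q-1}-2n+1\Big)\\&-\frac{4^k-1}{3}\Big(\frac{mq}{2q-1}-n\Big)\Big(\frac{mq}{2q-1}-n+1\Big).\end{aligned}$$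
   Context: The $q$-subdivision graph $S_q(G)$ is obtained from $G$ by replacing each edge $uv$ with $q$ disjoint paths of length $2$: $ux_1v,\ldots,ux_qv$. The iterated $q$-subdivision graphs are $S_{q,0}(G)=G$ and $S_{q,k}(G)=S_q(S_{q,k-1}(G))$ for $k\ge1$. For a connected graph $G$ with node degrees $d_i$, the resistance distance $r_{ij}$ is the effective resistance between $i$ and $j$ when each edge is replaced by a unit resistor. The additive degree-Kirchhoff index is $\bar{\mathcal K}(G)=\sum_{\{i,j\}\subseteq V(G)}(d_i+d_j)r_{ij}$ and the multiplicative degree-Kirchhoff index is $\tilde{\mathcal K}(G)=\sum_{\{i,j\}\subseteq V(G)}d_id_jr_{ij}$, the sums being over unordered pairs of nodes. *)

(* Defs.v *)
From HB Require Import structures.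
From mathcomp Require Import all_boot all_order all_algebra.
From mathcomp Require Import boolp classical_sets.

Set Implicit Arguments.
Unset Strict Implicit.
Unset Printing Implicit Defensive.

Import Order.TTheory GRing.Theory Num.Theory.
Local Open Scope ring_scope.

Record sgraph := SGraph {
  vertex :> finType;
  adj : rel vertex;
  adj_sym : symmetric adj;
  adj_irrefl : irreflexive adj
}.

Arguments adj {s} x y.

Definition connected_graph (G : sgraph) : Prop :=
  (0 < #|G|)%N /\ forall x y : G, connect adj x y.

Definition deg (G : sgraph) (x : G) : nat := #|[set y | adj x y]%SET|.

Definition edges (G : sgraph) : {set {set G}} :=
  [set [set p.1; p.2]%SET | p : G * G & adj p.1 p.2]%SET.

Section Subdivision.
Variables (q : nat) (G : sgraph).

Definition edge_type : finType := {e : {set G} | e \in edges G}.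

(* [inl u] is the old node u; [inr (e, i)] is the middle node of the i-th of
   the q paths of length 2 that replace the edge e. *)
Definition subdiv_vertex : finType := (G + edge_type * 'I_q)%type.

Definition subdiv_adj (x y : subdiv_vertex) : bool :=
  match x, y with
  | inl u, inr (e, _) => u \in val e
  | inr (e, _), inl u => u \in val e
  | _, _ => false
  end.

Lemma subdiv_adj_sym : symmetric subdiv_adj.
Proof. by move=> [u|[e i]] [v|[f j]]. Qed.

Lemma subdiv_adj_irrefl : irreflexive subdiv_adj.
Proof. by move=> [u|[e i]]. Qed.

Definition subdiv : sgraph := SGraph subdiv_adj_sym subdiv_adj_irrefl.

End Subdivision.

Definition iter_subdiv (q k : nat) (G : sgraph) : sgraph := iter k (subdiv q) G.

Section Kirchhoff.
Variables (R : realFieldType) (G : sgraph).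

(* Kirchhoff's current law and Ohm's law, all edges being unit resistors:
   v is a node potential for which a unit current enters at i and leaves at j.
   For i = j there is no net current. *)
Definition unit_current_potential (i j : G) (v : G -> R) : Prop :=
  forall x : G, \sum_(y | adj x y) (v x - v y) = (x == i)%:R - (x == j)%:R.

(* In a connected graph such a potential exists and is unique up to an additive
   constant, so that the set below is a singleton; the default value 0 only
   matters for disconnected graphs. *)
Definition resistance (i j : G) : R :=
  xget 0 [set r : R | exists v : G -> R,
            unit_current_potential i j v /\ r = v i - v j]%classic.

(* [enum_rank p.1 < enum_rank p.2] selects exactly one ordering of each
   unordered pair of distinct nodes. *)
Definition additive_kirchhoff : R :=
  \sum_(p : G * G | (enum_rank p.1 < enum_rank p.2)%N)
    ((deg p.1)%:R + (deg p.2)%:R) * resistance p.1 p.2.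

Definition multiplicative_kirchhoff : R :=
  \sum_(p : G * G | (enum_rank p.1 < enum_rank p.2)%N)
    (deg p.1)%:R * (deg p.2)%:R * resistance p.1 p.2.

End Kirchhoff.

(* Main.v *)
Require Import Defs.
From HB Require Import structures.
From mathcomp Require Import all_boot all_order all_algebra.
From mathcomp Require Import ring lra.
From mathcomp Require Import classical_sets.

Set Implicit Arguments.
Unset Strict Implicit.
Unset Printing Implicit Defensive.

Import Order.TTheory GRing.Theory Num.Theory.
Local Open Scope ring_scope.

(** Subdividing acts on resistances in a rigid way, so that the indices of
    [subdiv q H] are affine in those of [H]; the theorem solves this recursion.

    Resistances are governed by Klein's local sum rule
    [\sum_(y ~ x) (r x w + r x y - r y w) = 2 * (x != w)]
    ([resistance_sum_rule]), which follows from the expression of [r] by a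
    symmetric Green function of the Laplacian. Summing it over [x] kills the
    terms in [w], by antisymmetry, and leaves Foster's theorem: the resistances
    of the edges add up to the number of nodes minus one ([foster]). Applied at
    one node [x], it expresses all resistances from [x] by those from the
    neighbours of [x] ([resistance_from_neighbours]).

    In [subdiv q H], every edge of [H] has become [q] parallel paths of
    resistance 2, so resistances between old nodes are multiplied by [2 / q]
    ([resistance_old]). Middle nodes have two old neighbours, and the local rule
    eliminates them. All middle nodes being treated at once, the only
    contribution of the resistances between the ends of edges is their total,
    which Foster's theorem evaluates: the sum of the resistances from the middle
    nodes to [w] is a constant plus half of the sum from the old nodes, weighted
    by their degrees, less 1 when [w] is a middle node
    ([sum_resistance_mid]). Using this once for each argument of the resistance
    gives, with [n] nodes and [m] edges before subdivision,

    - [Kbar' = 4 Kbar + 4 q Ktil + 3 q^2 m^2 - 2 q m n + q m - n^2 + n],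
    - [Ktil' = 8 q Ktil + 2 q m (2 q m - 2 n + 1)].

    The numbers of edges and nodes after [k] steps are [(2q)^k m] and
    [n + q m ((2q)^k - 1) / (2q - 1)]. Hence the forcing term of the second
    recursion is a combination of [(2q)^(2k)] and [(2q)^k], while the
    homogeneous solution is [(8q)^k]. Exactly when [q = 2] one of the forcing
    exponentials is homogeneous, [(2q)^2 = 8q]: this resonance produces the term
    [k 16^k], and is why that case is separate. *)

(** * Laplacian, Green function and resistance *)

Section Laplacian.
Variables (R : realFieldType) (G : sgraph).
Implicit Types (u v : G -> R) (x y w : G).

Definition laplacian v x : R := \sum_(y | adj x y) (v x - v y).

Lemma sum_deg_const x (a : R) : \sum_(y | adj x y) a = (deg x)%:R * a.
Proof. by rewrite sumr_const -[_ *+ _]mulr_natl /deg cardsE. Qed.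

Lemma laplacianB u v x :
  laplacian (fun y => u y - v y) x = laplacian u x - laplacian v x.
Proof. by rewrite -sumrB; apply: eq_bigr => y _; ring. Qed.

Lemma exchange_adj (F : G -> G -> R) :
  \sum_x \sum_(y | adj x y) F x y = \sum_x \sum_(y | adj x y) F y x.
Proof.
rewrite (exchange_big_dep predT) //=; apply: eq_bigr => x _.
by apply: eq_bigl => y; rewrite adj_sym.
Qed.

Lemma laplacian_selfadjoint u v :
  \sum_x u x * laplacian v x = \sum_x laplacian u x * v x.
Proof.
pose D x y := u x * v x - u x * v y.
have -> : \sum_x u x * laplacian v x = \sum_x \sum_(y | adj x y) D x y.
  apply: eq_bigr => x _; rewrite big_distrr /=.
  by apply: eq_bigr => y _; rewrite mulrBr.
transitivity (\sum_x \sum_(y | adj x y) u x * v x -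
              \sum_x \sum_(y | adj x y) u x * v y).
  by rewrite -sumrB; apply: eq_bigr => x _; rewrite -sumrB.
rewrite [X in _ - X]exchange_adj -sumrB; apply: eq_bigr => x _.
by rewrite -sumrB big_distrl /=; apply: eq_bigr => y _; rewrite mulrBl.
Qed.

Lemma sum_laplacian v : \sum_x laplacian v x = 0.
Proof.
have := laplacian_selfadjoint (fun=> 1) v.
under eq_bigr => x _ do rewrite mul1r.
move=> ->; apply: big1 => x _; rewrite [laplacian _ _]big1 ?mul0r // => y _.
exact: subrr.
Qed.

Lemma dirichlet_energy v :
  \sum_x \sum_(y | adj x y) (v x - v y) ^+ 2 = 2 * \sum_x v x * laplacian v x.
Proof.
rewrite mulr_natl mulr2n.
have E : \sum_x v x * laplacian v x =
    \sum_x \sum_(y | adj x y) v x * (v x - v y).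
  by apply: eq_bigr => x _; rewrite big_distrr.
rewrite E [X in _ = _ + X]exchange_adj -big_split; apply: eq_bigr => x _.
by rewrite -big_split; apply: eq_bigr => y _ /=; ring.
Qed.

Hypothesis hG : connected_graph G.

(** The Dirichlet energy of a harmonic function vanishes, so the function does
    not vary along edges. *)
Lemma harmonic_const v : (forall x, laplacian v x = 0) -> forall x y, v x = v y.
Proof.
move=> harm.
have vadj x y : adj x y -> v x = v y.
  move=> xy; have := dirichlet_energy v.
  rewrite [X in 2 * X]big1 => [|z _]; last by rewrite harm mulr0.
  rewrite mulr0 => /eqP; rewrite psumr_eq0; last first.
    by move=> z _; apply: sumr_ge0 => t _; apply: sqr_ge0.
  move/allP/(_ x (mem_index_enum _)); rewrite /= psumr_eq0; last first.
    by move=> t _; apply: sqr_ge0.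
  move/allP/(_ y (mem_index_enum _)); rewrite xy /= sqrf_eq0 subr_eq0.
  by move/eqP.
move=> x y; have /connectP[p + ->] := hG.2 x y.
elim: p x => //= z p IH x /andP[xz zp].
by rewrite (vadj _ _ xz); apply: IH.
Qed.

Lemma card_vertex_neq0 : #|G|%:R != 0 :> R.
Proof. by rewrite pnatr_eq0 -lt0n hG.1. Qed.

(** The Laplacian plus the sum of the values is injective, because the sum over
    all nodes of its result recovers the sum of the values and a harmonic
    function of sum zero is zero. It is therefore onto, and the preimages of the
    point masses form [g]; they are symmetric since the operator is
    self-adjoint. *)
Lemma green_function : exists g : G -> G -> R,
  (forall x w, g x w = g w x) /\
  (forall w x, laplacian (g w) x = (x == w)%:R - #|G|%:R^-1).
Proof.
pose T (v : {ffun G -> R^o}) : {ffun G -> R^o} :=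
  [ffun x => laplacian v x + \sum_y v y].
have T_lin : linear T.
  move=> a u v; apply/ffunP => x; rewrite !ffunE /laplacian.
  have -> : \sum_y (a *: u + v) y = a * (\sum_y u y) + \sum_y v y.
    rewrite big_distrr -big_split /=; apply: eq_bigr => y _.
    by rewrite !ffunE.
  have -> : \sum_(y | adj x y) ((a *: u + v) x - (a *: u + v) y) =
      a * (\sum_(y | adj x y) (u x - u y)) + \sum_(y | adj x y) (v x - v y).
    rewrite big_distrr -big_split /=; apply: eq_bigr => y _.
    by rewrite !ffunE /= /GRing.scale /=; ring.
  by rewrite /GRing.scale /=; ring.
pose L := GRing.isLinear.Build R _ _ _ T T_lin.
pose TL : {linear {ffun G -> R^o} -> {ffun G -> R^o}} := HB.pack T L.
have Tsum (v : {ffun G -> R^o}) : \sum_x T v x = #|G|%:R * \sum_y v y.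
  under eq_bigr => x _ do rewrite ffunE.
  rewrite big_split /= sum_laplacian add0r sumr_const.
  by rewrite mulr_natl.
have Tinj : lker (linfun TL) == 0%VS.
  apply/lker0P => u v; rewrite !lfunE /= => Tuv.
  have Suv : \sum_y u y = \sum_y v y.
    by apply: (mulfI card_vertex_neq0); rewrite -!Tsum Tuv.
  have harm x : laplacian (fun y => u y - v y) x = 0.
    rewrite laplacianB; move/ffunP/(_ x): Tuv; rewrite !ffunE Suv.
    by move/addIr => ->; rewrite subrr.
  apply/ffunP => x; apply/eqP; rewrite -subr_eq0; apply/eqP.
  have : \sum_y (u y - v y) = 0 by rewrite sumrB Suv subrr.
  under eq_bigr => y _ do rewrite (harmonic_const harm y x).
  rewrite sumr_const -[_ *+ _]mulr_natl => /eqP.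
  by rewrite mulf_eq0 (negbTE card_vertex_neq0) => /eqP.
have Tsurj w : exists v : {ffun G -> R^o}, T v = [ffun x => (x == w)%:R].
  have : ([ffun x => (x == w)%:R] : {ffun G -> R^o}) \in limg (linfun TL).
    by rewrite (lker0_limgf Tinj) memvf.
  by case/memv_imgP => v _ ->; exists v; rewrite lfunE.
have [g Tg] := fin_all_exists Tsurj.
have gE w x : laplacian (g w) x + \sum_y g w y = (x == w)%:R.
  by have /ffunP/(_ x) := Tg w; rewrite !ffunE.
have gS w : \sum_y g w y = #|G|%:R^-1.
  apply: (mulfI card_vertex_neq0); rewrite -Tsum Tg divff ?card_vertex_neq0 //.
  under eq_bigr => x _ do rewrite ffunE.
  by rewrite (bigD1 w) //= eqxx big1 ?addr0 // => x /negbTE ->.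
have gL w x : laplacian (g w) x = (x == w)%:R - #|G|%:R^-1.
  by rewrite -gE gS addrK.
exists (fun x w => g x w); split=> // x w.
(* The subtracted constant is the same for all pairs, so that symmetry of the
   left-hand side makes [g] symmetric. *)
have pair a b : \sum_y g a y * laplacian (g b) y = g a b - #|G|%:R^-1 ^+ 2.
  under eq_bigr => y _ do rewrite gL mulrBr.
  rewrite sumrB -big_distrl /= gS -expr2; congr (_ - _).
  rewrite (bigD1 b) //= eqxx mulr1 big1 ?addr0 // => y /negbTE ->.
  by rewrite mulr0.
apply: (@addIr _ (- #|G|%:R^-1 ^+ 2)); rewrite -!pair laplacian_selfadjoint.
by apply: eq_bigr => y _; rewrite mulrC.
Qed.

Local Notation res := (@resistance R G).

(** Two potentials for the same current differ by a harmonic function. *)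
Lemma resistance_eq (i j : G) v :
  unit_current_potential i j v -> res i j = v i - v j.
Proof.
move=> hv; apply: xget_unique; first by exists v.
move=> r [u [hu ->]].
have harm x : laplacian (fun y => u y - v y) x = 0.
  by rewrite laplacianB /laplacian hu hv subrr.
by have := harmonic_const harm i j; lra.
Qed.

Lemma resistance_green : exists g : G -> G -> R,
  [/\ forall x w, g x w = g w x,
      forall w x, laplacian (g w) x = (x == w)%:R - #|G|%:R^-1 &
      forall i j, res i j = g i i + g j j - 2 * g i j].
Proof.
have [g [gC gL]] := green_function; exists g; split=> // i j.
rewrite (@resistance_eq i j (fun y => g i y - g j y)) => [|x].
  by rewrite (gC j i); ring.
by rewrite -/(laplacian _ x) laplacianB !gL; ring.
Qed.

Lemma potential_exists (i j : G) :
  exists v : G -> R, unit_current_potential i j v.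
Proof.
have [g [gC gL]] := green_function; exists (fun y => g i y - g j y) => x.
by rewrite -/(laplacian _ x) laplacianB !gL; ring.
Qed.

Lemma resistance_xx x : res x x = 0.
Proof. by have [g [_ _ ->]] := resistance_green; ring. Qed.

Lemma resistanceC x y : res x y = res y x.
Proof.
by have [g [gC _ rE]] := resistance_green; rewrite !rE (gC x y); ring.
Qed.

(** In terms of the Green function, the summand is twice the increment from [y]
    to [x] of [g x - g w], so the sum is twice a difference of two Laplacians
    at [x], in which the constant [#|G|^-1] cancels. *)
Lemma resistance_sum_rule x w :
  \sum_(y | adj x y) (res x w + res x y - res y w) = 2 * (x != w)%:R.
Proof.
have [g [gC gL rE]] := resistance_green.
transitivity (2 * (laplacian (g x) x - laplacian (g w) x)).
  rewrite -laplacianB big_distrr /=; apply: eq_bigr => y _.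
  by rewrite !rE (gC w x) (gC w y); ring.
by rewrite !gL eqxx; case: (x == w) => /=; ring.
Qed.

(** Foster's theorem, each edge being counted in both directions: the terms of
    the sum rule that involve [w] form a Laplacian, whose sum over all nodes is
    zero. *)
Lemma foster : \sum_x \sum_(y | adj x y) res x y = 2 * (#|G|%:R - 1).
Proof.
have /card_gt0P[w _] := hG.1.
transitivity (\sum_x \sum_(y | adj x y) (res x w + res x y - res y w)).
  transitivity (\sum_x (laplacian (fun z => res z w) x
                        + \sum_(y | adj x y) res x y)).
    by rewrite big_split /= sum_laplacian add0r.
  by apply: eq_bigr => x _; rewrite -big_split; apply: eq_bigr => y _ /=; ring.
under eq_bigr => x _ do rewrite resistance_sum_rule.
rewrite -big_distrr /=; congr (_ * _).
rewrite (bigD1 w) //= eqxx add0r -sum1_card natr_sum [in RHS](bigD1 w) //=.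
rewrite addrAC subrr add0r.
by apply: eq_bigr => x ->.
Qed.

(** Summing the sum rule at [x] over the neighbours [w] of [x] gives the total
    resistance [s] from [x] to its neighbours in terms of the resistances
    between neighbours; substituting [s] back eliminates it from the rule. *)
Lemma resistance_from_neighbours (x w : G) : (0 < deg x)%N ->
  (deg x)%:R * res x w =
    2 * (x != w)%:R - 1
    - (\sum_(y | adj x y) \sum_(z | adj x z) res y z) / (2 * (deg x)%:R)
    + \sum_(y | adj x y) res y w.
Proof.
move=> dx; set d : R := (deg x)%:R; set rho := \sum_(y | _) _.
have d0 : d != 0 by rewrite pnatr_eq0 -lt0n.
pose s := \sum_(y | adj x y) res x y.
have rule z : d * res x z = 2 * (x != z)%:R - s + \sum_(y | adj x y) res y z.
  by rewrite -resistance_sum_rule sumrB big_split /= sum_deg_const -/s; ring.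
have sE : 2 * d * s = 2 * d + rho.
  have : \sum_(z | adj x z) d * res x z =
         \sum_(z | adj x z) (2 - s + \sum_(y | adj x y) res y z).
    apply: eq_bigr => z xz; rewrite rule.
    by case: eqVneq xz => [->|_ _]; rewrite ?adj_irrefl ?mulr1.
  rewrite -big_distrr /= -/s big_split /= sum_deg_const exchange_big /= -/rho.
  move=> E.
  have <- : d * s - d * (2 - s) = rho by rewrite E; ring.
  by ring.
rewrite rule; have -> : rho = 2 * d * s - 2 * d by rewrite sE; ring.
by field.
Qed.

End Laplacian.

(** * Sums over edges *)

Section Edge_sums.
Variables (R : realFieldType) (G : sgraph).

Lemma adj_edge (u v : G) : adj u v -> [set u; v]%SET \in edges G.
Proof. by move=> uv; apply/imsetP; exists (u, v); rewrite ?inE. Qed.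

Lemma sum_incident_edges (u : G) (h : {set G} -> R) :
  \sum_(e : edge_type G | u \in val e) h (val e) =
  \sum_(v | adj u v) h [set u; v]%SET.
Proof.
rewrite -(big_sub_cond (mem (edges G)) (fun E : {set G} => u \in E) h) /=.
transitivity
  (\sum_(E in [set [set u; v]%SET | v in [pred v | adj u v]]%SET) h E).
  apply: eq_bigl => E; apply/andP/imsetP => [[/imsetP[[a b]]]|[v uv ->]].
    rewrite !inE /= => ab -> /set2P[] ->; first by exists b.
    by exists a; [rewrite inE adj_sym | rewrite finset.setUC].
  by split; [apply: adj_edge | rewrite finset.set21].
rewrite big_imset //= => a b ua ub /setP/(_ a).
rewrite !inE eqxx orbT /= => /esym/orP[] /eqP // au.
by move: ua; rewrite inE au adj_irrefl.
Qed.

Lemma sum_edge_ends (F : G -> {set G} -> R) :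
  \sum_(e : edge_type G) \sum_(u in val e) F u (val e) =
  \sum_u \sum_(v | adj u v) F u [set u; v]%SET.
Proof.
rewrite (exchange_big_dep predT) //=; apply: eq_bigr => u _.
exact: (sum_incident_edges u (F u)).
Qed.

Lemma sum_edge_ends_deg (f : G -> R) :
  \sum_(e : edge_type G) \sum_(u in val e) f u = \sum_u (deg u)%:R * f u.
Proof.
rewrite (sum_edge_ends (fun u _ => f u)); apply: eq_bigr => u _.
exact: sum_deg_const.
Qed.

Lemma sum_set2 (u v : G) (f : G -> R) :
  u != v -> \sum_(z in [set u; v]%SET) f z = f u + f v.
Proof. by move=> uv; rewrite big_setU1 ?big_set1 ?inE. Qed.

Lemma adj_neq (u v : G) : adj u v -> u != v.
Proof. by apply: contraTneq => ->; rewrite adj_irrefl. Qed.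

Lemma edgeP (e : edge_type G) : exists u v, adj u v /\ val e = [set u; v]%SET.
Proof. by have /imsetP[[u v] + ->] := valP e; rewrite inE; exists u, v. Qed.

Lemma card_edge_type : #|edge_type G| = #|edges G|.
Proof. by rewrite card_sig; apply: eq_card. Qed.

Lemma card_edge (e : edge_type G) : #|val e| = 2%N.
Proof.
by have [u [v [/adj_neq uv ->]]] := edgeP e; rewrite cards2 uv.
Qed.

Lemma handshake : \sum_(u : G) (deg u)%:R = 2 * #|edges G|%:R :> R.
Proof.
transitivity (\sum_(e : edge_type G) \sum_(u in val e) (1 : R)).
  by rewrite sum_edge_ends_deg; apply: eq_bigr => u _; rewrite mulr1.
under eq_bigr => e _ do rewrite sumr_const card_edge.
by rewrite sumr_const card_edge_type mulr_natr.
Qed.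

End Edge_sums.

(** * Degree-Kirchhoff indices as sums over ordered pairs *)

Section Kirchhoff_sums.
Variables (R : realFieldType) (G : sgraph).
Hypothesis hG : connected_graph G.

Lemma sum_unordered_pairs (F : G -> G -> R) :
  (forall x y, F x y = F y x) -> (forall x, F x x = 0) ->
  \sum_x \sum_y F x y =
  2 * \sum_(p : G * G | (enum_rank p.1 < enum_rank p.2)%N) F p.1 p.2.
Proof.
move=> FC F0; set S := (X in 2 * X).
have SE : S = \sum_x \sum_(y | (enum_rank x < enum_rank y)%N) F x y.
  by rewrite pair_big_dep.
transitivity (S + S); last by ring.
rewrite SE [X in _ = _ + X](exchange_big_dep predT) //= -big_split /=.
apply: eq_bigr => x _.
rewrite (bigID (fun y => (enum_rank x < enum_rank y)%N)) /=; congr (_ + _).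
rewrite (bigD1 x) ?ltnn //= F0 add0r.
apply: eq_big => [y|y _]; last exact: FC.
rewrite -leqNgt andbC ltn_neqAle; congr (_ && _).
by rewrite (inj_eq val_inj) (inj_eq enum_rank_inj).
Qed.

Lemma additive_kirchhoffE :
  additive_kirchhoff R G = \sum_x \sum_y (deg x)%:R * @resistance R G x y.
Proof.
set S := RHS.
have two_neq0 : 2 != 0 :> R by rewrite pnatr_eq0.
apply: (mulfI two_neq0).
rewrite -(@sum_unordered_pairs
  (fun x y => ((deg x)%:R + (deg y)%:R) * @resistance R G x y)); first last.
- by move=> x; rewrite resistance_xx ?mulr0.
- by move=> x y; rewrite resistanceC // addrC.
transitivity (S + S); last by ring.
rewrite [X in _ = X + S]exchange_big -big_split; apply: eq_bigr => x _.
rewrite -big_split; apply: eq_bigr => y _ /=.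
by rewrite (resistanceC R hG y x); ring.
Qed.

Lemma multiplicative_kirchhoffE :
  2 * multiplicative_kirchhoff R G =
  \sum_x \sum_y (deg x)%:R * (deg y)%:R * @resistance R G x y.
Proof.
rewrite (@sum_unordered_pairs
  (fun x y => (deg x)%:R * (deg y)%:R * @resistance R G x y)) //.
- by move=> x y; rewrite resistanceC // (mulrC (deg x)%:R).
- by move=> x; rewrite resistance_xx ?mulr0.
Qed.

End Kirchhoff_sums.

(** * Resistances and indices of the subdivided graph *)

Section Subdivided_graph.
Variables (R : realFieldType) (q : nat) (G : sgraph).
Local Notation H := (subdiv q G).
Local Notation old u := (inl u : H).
Local Notation mid e i := (inr (e, i) : H).
Local Notation Q := (q%:R : R).

Lemma sum_subdiv (F : H -> R) :
  \sum_x F x = \sum_u F (old u) + \sum_e \sum_(i < q) F (mid e i).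
Proof.
rewrite big_sumType /= pair_bigA; congr (_ + _).
by apply: eq_bigr => -[].
Qed.

Lemma sum_adj_old (u : G) (F : H -> R) :
  \sum_(y | adj (old u) y) F y =
  \sum_(e : edge_type G | u \in val e) \sum_(i < q) F (mid e i).
Proof.
rewrite big_sumType /= big_pred0_eq add0r pair_big_dep /=.
by apply: eq_big => [[e i]|[e i]] //=; rewrite ?andbT.
Qed.

Lemma sum_adj_mid (e : edge_type G) (i : 'I_q) (F : H -> R) :
  \sum_(y | adj (mid e i) y) F y = \sum_(u in val e) F (old u).
Proof.
by rewrite big_sumType /= [X in _ + X]big_pred0 ?addr0 // => -[].
Qed.

Lemma sum_mid_copies (f : edge_type G -> R) :
  \sum_e \sum_(i < q) f e = Q * \sum_e f e.
Proof.
rewrite big_distrr; apply: eq_bigr => e _.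
by rewrite sumr_const card_ord /= mulr_natl.
Qed.

Lemma sum_mid_const (a : R) :
  \sum_(e : edge_type G) \sum_(i < q) a = Q * #|edges G|%:R * a.
Proof.
by rewrite sum_mid_copies sumr_const card_edge_type -[a *+ _]mulr_natl mulrA.
Qed.

Lemma natr_deg (x : H) : (deg x)%:R = \sum_(y | adj x y) 1 :> R.
Proof. by rewrite sum_deg_const mulr1. Qed.

Lemma deg_old (u : G) : (deg (old u))%:R = Q * (deg u)%:R.
Proof.
rewrite natr_deg sum_adj_old.
under eq_bigr => e _ do rewrite sumr_const card_ord.
by rewrite (@sum_incident_edges R G u (fun _ => Q)) sum_deg_const mulrC.
Qed.

Lemma deg_mid (e : edge_type G) (i : 'I_q) : deg (mid e i) = 2%N.
Proof.
(* Counting inside [R], of characteristic 0, reuses the sum over neighbours. *)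
apply/eqP; rewrite -(eqr_nat R) natr_deg sum_adj_mid sumr_const card_edge.
exact: eqxx.
Qed.

Lemma card_subdiv : #|H|%:R = #|G|%:R + Q * #|edges G|%:R :> R.
Proof.
by rewrite card_sum card_prod card_edge_type card_ord natrD natrM mulrC.
Qed.

Lemma card_edges_subdiv : #|edges H|%:R = 2 * Q * #|edges G|%:R :> R.
Proof.
have two_neq0 : 2 != 0 :> R by rewrite pnatr_eq0.
apply: (mulfI two_neq0).
rewrite -(handshake R H) sum_subdiv.
under eq_bigr => u _ do rewrite deg_old.
rewrite -big_distrr /= handshake.
under eq_bigr => e _ do under eq_bigr => i _ do rewrite deg_mid.
by rewrite sum_mid_const; ring.
Qed.

Hypothesis q_gt0 : (0 < q)%N.
Hypothesis hG : connected_graph G.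

Lemma connected_subdiv : connected_graph H.
Proof.
split; first by have /card_gt0P[u _] := hG.1; apply/card_gt0P; exists (old u).
have csym : connect_sym (@adj H) by apply/sym_connect_sym/adj_sym.
have old_old u v : connect adj (old u) (old v).
  have /connectP[p] := hG.2 u v; elim: p u => [|z p IH] u /= => [_ ->|].
    exact: connect0.
  case/andP=> uz zp vE; apply: connect_trans (IH z zp vE).
  pose e : edge_type G := Sub [set u; z]%SET (adj_edge uz).
  apply: (@connect_trans _ _ (mid e (Ordinal q_gt0))); apply: connect1 => /=.
    exact: finset.set21.
  exact: finset.set22.
have to_old x : exists u, connect adj x (old u).
  case: x => [u|[e i]]; first by exists u; apply: connect0.
  have [u [v [_ eE]]] := edgeP e; exists u; apply: connect1.
  by rewrite /= eE finset.set21.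
move=> x y; have [u xu] := to_old x; have [v yv] := to_old y.
apply: connect_trans xu (connect_trans (old_old u v) _).
by rewrite csym.
Qed.

Local Notation hH := connected_subdiv.
Local Notation r := (@resistance R G).
Local Notation r' := (@resistance R H).

Lemma Q_neq0 : Q != 0. Proof. by rewrite pnatr_eq0 -lt0n. Qed.

(** A potential on [G], scaled by [2 / q], extends to the middle nodes by the
    average of its values at the two ends: no current is then lost there, and
    each of the [q] paths along an edge carries the [q]-th part of the original
    current. *)
Lemma resistance_old (u v : G) : r' (old u) (old v) = 2 / Q * r u v.
Proof.
have [p hp] := potential_exists R hG u v.
pose p' (x : H) : R := match x with
  | inl z => 2 / Q * p z
  | inr (e, _) => Q^-1 * \sum_(z in val e) p z
  end.
rewrite (resistance_eq hH (v := p')) => [|[z|[e i]]].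
- by rewrite (resistance_eq hG hp) //= mulrBr.
- rewrite sum_adj_old /=.
  under eq_bigr => e _ do rewrite sumr_const card_ord -[_ *+ q]mulr_natl.
  pose h (E : {set G}) := Q * (2 / Q * p z - Q^-1 * \sum_(t in E) p t).
  rewrite -[LHS]/(\sum_(e : edge_type G | z \in val e) h (val e)).
  rewrite sum_incident_edges -hp /h.
  apply: eq_bigr => t /adj_neq zt; rewrite sum_set2 //.
  by field; apply: Q_neq0.
- rewrite sum_adj_mid /= sumrB sumr_const card_edge -big_distrr /=.
  by rewrite subrr -mulrA -mulr_natl; ring.
Qed.

Local Notation n := (#|G|%:R : R).
Local Notation m := (#|edges G|%:R : R).
Local Notation c := ((Q * m - n + 1) / 2).
Local Notation B := (additive_kirchhoff R G).
Local Notation K := (multiplicative_kirchhoff R G).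

Definition is_mid (x : H) : bool := if x is inr _ then true else false.

(** The weights [q * deg u] are the degrees of the old nodes in [subdiv q G]. *)
Definition old_sum (w : H) : R := \sum_u Q * (deg u)%:R * r' (old u) w.

(** Sum of [resistance_from_neighbours] over all middle nodes: Foster's theorem
    evaluates the part that does not depend on [w], and each old node [u] is
    adjacent to [q * deg u] middle nodes. The term [is_mid w] is the one middle
    node that may be equal to [w]. *)
Lemma sum_resistance_mid w :
  \sum_(e : edge_type G) \sum_(i < q) r' (mid e i) w =
  c - (is_mid w)%:R + old_sum w / 2.
Proof.
pose rho (E : {set G}) : R := \sum_(y in E) \sum_(z in E) r y z.
pose T E w := \sum_(u in E : {set G}) r' (old u) w.
have midE e i : r' (mid e i) w =
    2^-1 - (mid e i == w)%:R - rho (val e) / (4 * Q) + T (val e) w / 2.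
  have := @resistance_from_neighbours R _ hH (mid e i) w.
  rewrite deg_mid => /(_ isT).
  have -> : \sum_(y | adj (mid e i) y) \sum_(z | adj (mid e i) z) r' y z =
      2 / Q * rho (val e).
    rewrite sum_adj_mid /rho mulr_sumr; apply: eq_bigr => y _.
    rewrite sum_adj_mid mulr_sumr; apply: eq_bigr => z _.
    exact: resistance_old.
  rewrite sum_adj_mid -/(T (val e) w) => E.
  have two_neq0 : 2 != 0 :> R by rewrite pnatr_eq0.
  apply: (mulfI two_neq0).
  by rewrite E; case: (_ == _) => /=; field; apply: Q_neq0.
have rho_sum : \sum_(e : edge_type G) rho (val e) = 2 * (n - 1).
  rewrite (sum_edge_ends (fun y E => \sum_(z in E) r y z)) -foster //.
  apply: eq_bigr => u _; apply: eq_bigr => v /adj_neq uv.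
  by rewrite sum_set2 // resistance_xx ?add0r.
have T_sum : \sum_(e : edge_type G) T (val e) w = old_sum w / Q.
  rewrite /T sum_edge_ends_deg big_distrl /=; apply: eq_bigr => u _.
  by field; apply: Q_neq0.
have new_sum : \sum_(e : edge_type G) \sum_(i < q) (mid e i == w)%:R =
    (is_mid w)%:R :> R.
  rewrite pair_bigA /=; case: (w) => [u|x] /=; first exact: big1.
  rewrite (bigD1 x) //= -surjective_pairing eqxx big1 ?addr0 // => -[e i] /=.
  by move=> /negbTE neq; rewrite -[_ == _]/((e, i) == x) neq.
transitivity (\sum_(e : edge_type G) \sum_(i < q) 2^-1
   - \sum_(e : edge_type G) \sum_(i < q) (mid e i == w)%:R
   - \sum_(e : edge_type G) \sum_(i < q) rho (val e) / (4 * Q)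
   + \sum_(e : edge_type G) \sum_(i < q) T (val e) w / 2).
  rewrite -!sumrB -big_split; apply: eq_bigr => e _.
  by rewrite -!sumrB -big_split; apply: eq_bigr => i _; apply: midE.
rewrite new_sum sum_mid_const !sum_mid_copies -!big_distrl /= rho_sum T_sum.
by field; apply: Q_neq0.
Qed.

Lemma sum_old_sum_old : \sum_u old_sum (old u) = 2 * B.
Proof.
rewrite additive_kirchhoffE // exchange_big big_distrr.
apply: eq_bigr => u _ /=.
rewrite big_distrr; apply: eq_bigr => v _ /=.
by rewrite resistance_old; field; apply: Q_neq0.
Qed.

Lemma sum_deg_old_sum_old : \sum_u Q * (deg u)%:R * old_sum (old u) = 4 * Q * K.
Proof.
have -> : 4 * Q * K = 2 * Q * (2 * K) by ring.
rewrite multiplicative_kirchhoffE // big_distrr; apply: eq_bigr => u _ /=.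
rewrite !big_distrr; apply: eq_bigr => v _ /=.
by rewrite resistance_old (resistanceC R hG v u); field; apply: Q_neq0.
Qed.

(** By symmetry of resistances, exchanging the sums brings the total resistance
    from the middle nodes to an old node, which is already known. *)
Lemma sum_old_sum_mid :
  \sum_(e : edge_type G) \sum_(i < q) old_sum (mid e i) =
  2 * m * Q * c + 2 * Q * K.
Proof.
set b := c.
have -> : \sum_(e : edge_type G) \sum_(i < q) old_sum (mid e i) =
    \sum_u Q * (deg u)%:R * (b + old_sum (old u) / 2).
  under eq_bigr => e _ do rewrite exchange_big.
  rewrite exchange_big; apply: eq_bigr => u _ /=.
  have -> : b + old_sum (old u) / 2 =
      c - (is_mid (old u))%:R + old_sum (old u) / 2.
    by rewrite subr0.
  rewrite -sum_resistance_mid big_distrr; apply: eq_bigr => e _ /=.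
  rewrite big_distrr; apply: eq_bigr => i _ /=.
  by rewrite (resistanceC R hH).
under eq_bigr => u _ do rewrite mulrDr mulrA.
rewrite big_split /= -!big_distrl /= sum_deg_old_sum_old.
rewrite -big_distrr /= handshake.
by field.
Qed.

Lemma sum_deg_resistance w :
  \sum_x (deg x)%:R * r' x w = 2 * old_sum w + 2 * c - 2 * (is_mid w)%:R.
Proof.
rewrite sum_subdiv.
under eq_bigr => u _ do rewrite deg_old.
under [X in _ + X]eq_bigr => e _.
  under eq_bigr => i _ do rewrite deg_mid.
  rewrite -big_distrr.
  over.
by rewrite -big_distrr /= sum_resistance_mid -/(old_sum w); field.
Qed.

Lemma additive_kirchhoff_subdiv :
  additive_kirchhoff R H =
  4 * B + 4 * Q * K + 3 * Q ^+ 2 * m ^+ 2 - 2 * Q * m * n + Q * m - n ^+ 2 + n.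
Proof.
rewrite additive_kirchhoffE; last exact: hH.
rewrite exchange_big /=.
under eq_bigr => w _ do rewrite sum_deg_resistance.
have sum_const : \sum_(w : H) 2 * c = (n + Q * m) * (2 * c).
  by rewrite sumr_const -[LHS]mulr_natl card_subdiv.
rewrite sumrB big_split /= sum_const -!mulr_sumr.
rewrite !sum_subdiv /= sum_old_sum_old sum_old_sum_mid big1_eq add0r.
by rewrite sum_mid_const; field.
Qed.

Lemma multiplicative_kirchhoff_subdiv :
  multiplicative_kirchhoff R H =
  8 * Q * K + 2 * Q * m * (2 * Q * m - 2 * n + 1).
Proof.
have two_neq0 : 2 != 0 :> R by rewrite pnatr_eq0.
apply: (mulfI two_neq0); rewrite multiplicative_kirchhoffE; last exact: hH.
rewrite exchange_big /=.
transitivity (\sum_w (deg w)%:R * (2 * old_sum w + 2 * c - 2 * (is_mid w)%:R)).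
  apply: eq_bigr => w _; rewrite -sum_deg_resistance big_distrr.
  by apply: eq_bigr => x _ /=; ring.
rewrite sum_subdiv.
transitivity (2 * \sum_u Q * (deg u)%:R * old_sum (old u) +
   2 * c * Q * \sum_(u : G) (deg u)%:R +
   (4 * \sum_(e : edge_type G) \sum_(i < q) old_sum (mid e i) +
    \sum_(e : edge_type G) \sum_(i < q) (4 * c - 4))).
  congr (_ + _).
    rewrite !big_distrr -big_split; apply: eq_bigr => u _ /=.
    by rewrite deg_old; ring.
  rewrite big_distrr -big_split; apply: eq_bigr => e _ /=.
  rewrite big_distrr -big_split; apply: eq_bigr => i _ /=.
  by rewrite deg_mid; ring.
by rewrite sum_deg_old_sum_old handshake sum_old_sum_mid sum_mid_const; field.
Qed.

End Subdivided_graph.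

(** * Solving the recursion *)

Section Iterated_subdivision.
Variables (R : realFieldType) (q : nat) (G : sgraph).
Hypothesis q_gt0 : (0 < q)%N.
Hypothesis hG : connected_graph G.
Local Notation Q := (q%:R : R).
Local Notation n := (#|G|%:R : R).
Local Notation m := (#|edges G|%:R : R).
Local Notation Gk k := (iter_subdiv q k G).
Local Notation Kbar k := (additive_kirchhoff R (Gk k)).
Local Notation Ktil k := (multiplicative_kirchhoff R (Gk k)).

Lemma connected_iter_subdiv k : connected_graph (Gk k).
Proof. by elim: k => //= k IH; apply: connected_subdiv. Qed.

Lemma Q_ge1 : 1 <= Q. Proof. by rewrite ler1n. Qed.

Lemma two_Q_sub1_neq0 : 2 * Q - 1 != 0.
Proof. by apply/lt0r_neq0; have := Q_ge1; lra. Qed.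

Lemma Q_add1_neq0 : Q + 1 != 0.
Proof. by apply/lt0r_neq0; have := Q_ge1; lra. Qed.

Lemma card_edges_iter_subdiv k : #|edges (Gk k)|%:R = (2 * Q) ^+ k * m.
Proof.
elim: k => [|k IH]; first by rewrite expr0 mul1r.
by rewrite [LHS]card_edges_subdiv IH exprS; ring.
Qed.

Lemma card_iter_subdiv k :
  #|Gk k|%:R = n + Q * m * ((2 * Q) ^+ k - 1) / (2 * Q - 1).
Proof.
elim: k => [|k IH]; first by rewrite expr0 subrr mulr0 mul0r addr0.
rewrite [LHS]card_subdiv card_edges_iter_subdiv IH exprS.
by field; apply: two_Q_sub1_neq0.
Qed.

Lemma additive_kirchhoff_iterS k :
  Kbar k.+1 =
  let n' : R := n + Q * m * ((2 * Q) ^+ k - 1) / (2 * Q - 1) in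
  let m' : R := (2 * Q) ^+ k * m in
  4 * Kbar k + 4 * Q * Ktil k + 3 * Q ^+ 2 * m' ^+ 2 - 2 * Q * m' * n'
  + Q * m' - n' ^+ 2 + n'.
Proof.
rewrite /= -card_iter_subdiv -card_edges_iter_subdiv.
exact: additive_kirchhoff_subdiv (connected_iter_subdiv k).
Qed.

Lemma multiplicative_kirchhoff_iterS k :
  Ktil k.+1 =
  let n' : R := n + Q * m * ((2 * Q) ^+ k - 1) / (2 * Q - 1) in
  let m' : R := (2 * Q) ^+ k * m in
  8 * Q * Ktil k + 2 * Q * m' * (2 * Q * m' - 2 * n' + 1).
Proof.
rewrite /= -card_iter_subdiv -card_edges_iter_subdiv.
exact: multiplicative_kirchhoff_subdiv (connected_iter_subdiv k).
Qed.

Local Notation A k := ((2 * Q) ^+ k : R).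
Local Notation F k := (4 ^+ k : R).
Local Notation c := (1 - 2 * n + 2 * Q * m / (2 * Q - 1)).

Lemma pow_2Q_S k : A k.+1 = 2 * Q * A k. Proof. exact: exprS. Qed.
Lemma pow4_S k : F k.+1 = 4 * F k. Proof. exact: exprS. Qed.

Lemma pow_8Q k : (8 * Q) ^+ k = F k * A k.
Proof. by rewrite -exprMn; congr (_ ^+ _); ring. Qed.

Section Generic.
Hypothesis q_neq2 : q <> 2%N.

Lemma Q_sub2_neq0 : Q - 2 != 0.
Proof. by rewrite subr_eq0 eqr_nat; apply/eqP. Qed.

(** The coefficients of the particular solution come from inserting
    [a * (2q)^(2k)] and [b * (2q)^k] into the recursion: the forcing terms are
    divided by [(2q)^2 - 8q = 4q (q - 2)] and by [2q - 8q = - 6q]. *)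
Lemma multiplicative_kirchhoff_iter k :
  Ktil k = F k * A k * Ktil 0%N
    + 2 * Q * (Q - 1) * m ^+ 2 / ((2 * Q - 1) * (Q - 2))
      * (A k ^+ 2 - F k * A k)
    - m * c / 3 * (A k - F k * A k).
Proof.
elim: k => [|k IH]; first by rewrite !expr0; ring.
rewrite multiplicative_kirchhoff_iterS IH pow_2Q_S pow4_S /=.
by field; rewrite Q_sub2_neq0 two_Q_sub1_neq0.
Qed.

Lemma additive_kirchhoff_iter k :
  Kbar k =
    F k * Kbar 0%N
    + 3 * m ^+ 2 * Q ^+ 3 * (Q - 1) * (A k ^+ 2 - F k)
      / ((Q - 2) * (Q + 1) * (2 * Q - 1) ^+ 2)
    + (F k * A k - F k) / (2 * Q - 1)
      * (Q * Ktil 0%N - 2 * m ^+ 2 * Q ^+ 2 / (3 * (Q - 2))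
         - m * (2 * n - 1) * Q / 3)
    - m * Q * (A k - F k) / (3 * (2 * Q - 1))
      * (2 * m * Q / (2 * Q - 1) - 2 * n + 1)
    - (F k - 1) / 3
      * (m * Q / (2 * Q - 1) - n)
      * (m * Q / (2 * Q - 1) - n + 1).
Proof.
elim: k => [|k IH]; first by rewrite !expr0; ring.
rewrite additive_kirchhoff_iterS IH (multiplicative_kirchhoff_iter k).
rewrite pow_2Q_S pow4_S /=.
by field; rewrite Q_sub2_neq0 two_Q_sub1_neq0 Q_add1_neq0.
Qed.

End Generic.

Section Resonant.
Hypothesis q_eq2 : q = 2%N.

Lemma pow_2Q_resonant k : A k = F k.
Proof. by rewrite q_eq2; congr (_ ^+ _); ring. Qed.

(** Here [(2q)^(2k)] and [(8q)^k] are both [16^k], so that the particular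
    solution takes the form [a * k * 16^k]. *)
Lemma multiplicative_kirchhoff_iter_resonant k :
  Ktil k = F k ^+ 2 * Ktil 0%N + 2 * m ^+ 2 / 3 * k%:R * F k ^+ 2
    - m * (1 - 2 * n + 4 * m / 3) / 3 * (F k - F k ^+ 2).
Proof.
elim: k => [|k IH]; first by rewrite !expr0; ring.
rewrite multiplicative_kirchhoff_iterS IH pow_2Q_resonant pow4_S.
have -> : Q = 2 by rewrite q_eq2.
by rewrite -[k.+1%:R]natr1 /=; field.
Qed.

Lemma additive_kirchhoff_iter_resonant k :
  Kbar k =
    F k * Kbar 0%N
    + 2 * (F k ^+ 2 - F k) * Ktil 0%N / 3
    + (F k ^+ 2 - F k) / 9 * (2 * m * (2 * m - 2 * n + 1))
    + F k ^+ 2 / 9 * (4 * m ^+ 2 * k%:R)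
    - (F k - 1) / 27 * (2 * m - 3 * n) * (2 * m - 3 * n + 3).
Proof.
elim: k => [|k IH]; first by rewrite !expr0; ring.
rewrite additive_kirchhoff_iterS IH (multiplicative_kirchhoff_iter_resonant k).
rewrite pow_2Q_resonant pow4_S.
have -> : Q = 2 by rewrite q_eq2.
by rewrite -[k.+1%:R]natr1 /=; field.
Qed.

End Resonant.

End Iterated_subdivision.

Theorem theorem7p3 (R : realFieldType) (q k : nat) (hq : (1 <= q)%N)
    (G : sgraph) (hG : connected_graph G) :
  let n : R := #|G|%:R in
  let m : R := #|edges G|%:R in
  let Q : R := q%:R in
  let Kbar (j : nat) : R := additive_kirchhoff R (iter_subdiv q j G) in
  let Ktil (j : nat) : R := multiplicative_kirchhoff R (iter_subdiv q j G) in
  (q = 2%N ->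
     Kbar k =
       4 ^+ k * Kbar 0%N
       + 2 * (16 ^+ k - 4 ^+ k) * Ktil 0%N / 3
       + (16 ^+ k - 4 ^+ k) / 9 * (2 * m * (2 * m - 2 * n + 1))
       + 16 ^+ k / 9 * (4 * m ^+ 2 * k%:R)
       - (4 ^+ k - 1) / 27 * (2 * m - 3 * n) * (2 * m - 3 * n + 3))
  /\
  (q <> 2%N ->
     Kbar k =
       4 ^+ k * Kbar 0%N
       + 3 * m ^+ 2 * Q ^+ 3 * (Q - 1) * ((2 * Q) ^+ (2 * k) - 4 ^+ k)
         / ((Q - 2) * (Q + 1) * (2 * Q - 1) ^+ 2)
       + ((8 * Q) ^+ k - 4 ^+ k) / (2 * Q - 1)
         * (Q * Ktil 0%N - 2 * m ^+ 2 * Q ^+ 2 / (3 * (Q - 2))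
            - m * (2 * n - 1) * Q / 3)
       - m * Q * ((2 * Q) ^+ k - 4 ^+ k) / (3 * (2 * Q - 1))
         * (2 * m * Q / (2 * Q - 1) - 2 * n + 1)
       - (4 ^+ k - 1) / 3
         * (m * Q / (2 * Q - 1) - n)
         * (m * Q / (2 * Q - 1) - n + 1)).
Proof.
move=> n m Q Kbar Ktil; split=> q2.
  have -> : 16 ^+ k = (4 ^+ k) ^+ 2 :> R.
    by rewrite exprAC; congr (_ ^+ _); ring.
  exact: additive_kirchhoff_iter_resonant.
rewrite pow_8Q mulnC exprM.
exact: additive_kirchhoff_iter.
Qed.
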